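(* Let $M=US$ be a $(U,S)$-proper monoid, where $U$ and $S$ are submonoids, with $U$ commutative (respectively, a semilattice). Then there exist a monoid $\mathcal U_C$, a semidirect product $\mathcal M=\mathcal U_C\rtimes(S/\sigma)$ and an embedding $\psi:M\to\mathcal M$ such that: (i) $\mathcal U_C$ is commutative (respectively, a semilattice); (ii) $\mathcal U_C$ contains a subsemigroup $U'$ isomorphic to $U$; (iii) $\psi|_U:U\to U'\times\{\widehat 1\}$ (the subsemigroup $U'\rtimes\{\widehat1\}$ of $\mathcal M$) is an isomorphism.
   Context: A semilattice is a commutative semigroup all of whose elements are idempotent. For a subsemigroup $U$ of a monoid $M$ with identity $1$, $U^1=U\cup\{1\}$. An action pair in $M$ is a pair $(U,S)$ of subsemigroups of $M$ together with a left action $(s,u)\mapsto{}^su$ of $S$ on $U^1$ by semigroup morphisms (${}^s({}^tu)={}^{st}u$, ${}^s(uv)={}^su\cdot{}^sv$) such that (A1) $s\cdot u={}^su\cdot s$ for all $s\in S,u\in U^1$, and (A2) $us=vt\Rightarrow u\cdot{}^s1=v\cdot{}^t1$ for all $u,v\in U^1$, $s,t\in S$. Write $s^+={}^s1$, $S^+=\{s^+:s\in S\}$, and let $P=\langle S^+\rangle$ be the subsemigroup of $U^1$ generated by $S^+$. Let $\kappa=\{(s,t)\in S\times S:ps=qt\text{ for some }p,q\in P\}$ and let $\sigma=\kappa^\sharp$ be the congruence on $S$ generated by $\kappa$. The $\sigma$-class of $s\in S$ is denoted $\widehat s$. The pair $(U,S)$ is proper if for all $u,v\in U^1$, $s,t\in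 S$: $us=vt\iff us^+=vt^+$ and $s\mathrel\sigma t$. ''$M=US$ is a $(U,S)$-proper monoid'' means: $(U,S)$ is a proper action pair in the monoid $M$, $U$ and $S$ are both submonoids of $M$, and $M=US=\{us:u\in U,s\in S\}$. A semidirect product $\mathcal U\rtimes T$ of a monoid $\mathcal U$ and a semigroup $T$ is formed from a left action of $T$ on $\mathcal U$ by semigroup morphisms, with product $(u,s)(v,t)=(u\cdot{}^sv,st)$ on the set $\mathcal U\times T$. An embedding is an injective semigroup morphism. *)

(* Defs.v *)
From HB Require Import structures.
From mathcomp Require Import all_boot.
From mathcomp Require Import generic_quotient boolp classical_sets.

Set Implicit Arguments.
Unset Strict Implicit.
Unset Printing Implicit Defensive.

Local Open Scope group_scope.
Local Open Scope classical_set_scope.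

Definition commutative_semigroup (G : semigroupType) : Prop :=
  commutative (@mul G).

Definition semilattice (G : semigroupType) : Prop :=
  commutative_semigroup G /\ idempotent_op (@mul G).

(* A subsemigroup (submonoid) of M is an [A : mulgClosed M]
   ([A : umagmaClosed M]); [sub A] is A as a semigroup (monoid). *)
Definition sub (M : semigroupType) (A : {pred M}) : Type := {x : M | x \in A}.

Section Sub.
Variables (M : semigroupType) (A : {pred M}).
HB.instance Definition _ := SubType.copy (sub A) {x : M | x \in A}.
HB.instance Definition _ := [Choice of sub A by <:].
End Sub.

HB.instance Definition _ (M : semigroupType) (A : mulgClosed M) :=
  SubChoice_isSubSemigroup.Build M _ (sub A) (@gpredM _ A).

Section SubMonoid.
Variables (M : monoidType) (A : umagmaClosed M).

Let one_sub : sub A := Sub (1 : M) (@gpred1 _ A).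

Fact sub_mul1g : left_id one_sub *%g.
Proof. by move=> x; apply: val_inj; rewrite valM mul1g. Qed.

Fact sub_mulg1 : right_id one_sub *%g.
Proof. by move=> x; apply: val_inj; rewrite valM mulg1. Qed.

HB.instance Definition _ :=
  Magma_isUMagma.Build (sub A) sub_mul1g sub_mulg1.
End SubMonoid.

(* U^1 = U \cup {1} *)
Section AdjoinOne.
Variables (M : monoidType) (U : mulgClosed M).

Definition adjoin1 : {pred M} := [predU1 1 & U].

Fact adjoin1_1 : 1 \in adjoin1.
Proof. by rewrite !inE eqxx. Qed.

Fact adjoin1_mulg_closed : mulg_closed adjoin1.
Proof.
move=> x y; rewrite !inE => /predU1P[->|xU] /predU1P[->|yU].
- by rewrite mulg1 eqxx.
- by rewrite mul1g yU orbT.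
- by rewrite mulg1 xU orbT.
- by rewrite gpredM ?orbT.
Qed.

HB.instance Definition _ := isMulClosed.Build M adjoin1 adjoin1_mulg_closed.
HB.instance Definition _ := isMul1Closed.Build M adjoin1 adjoin1_1.
End AdjoinOne.

(* Left actions of a semigroup T on a semigroup A by semigroup morphisms. *)
Record sgaction (T A : semigroupType) := SgAction {
  sgact :> T -> A -> A;
  sgactM : forall s t u, sgact s (sgact t u) = sgact (s * t) u;
  sgact_morph : forall s, {morph sgact s : u v / u * v}
}.

Definition semidirect (T A : semigroupType) (act : sgaction T A) : Type :=
  (A * T)%type.

Section Semidirect.
Variables (T A : semigroupType) (act : sgaction T A).

HB.instance Definition _ := Choice.copy (semidirect act) (A * T)%type.

Let sdmul (x y : semidirect act) : semidirect act :=
  (x.1 * act x.2 y.1, x.2 * y.2).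

Fact sdmulA : associative sdmul.
Proof.
by move=> x y z; rewrite /sdmul /= sgact_morph sgactM !mulgA.
Qed.

HB.instance Definition _ := isSemigroup.Build (semidirect act) sdmulA.
End Semidirect.

(* U' x {t} as a subset of the semidirect product *)
Definition slice (T A : semigroupType) (act : sgaction T A)
    (U' : {pred A}) (t : T) : {pred semidirect act} :=
  [pred x : semidirect act | (x.1 \in U') && (x.2 == t)].
Arguments slice [T A] act U' t.

Definition isomorphic (G H : semigroupType) : Prop :=
  exists f : {multiplicative G -> H}, bijective f.

Definition generated (G : semigroupType) (X : set G) : set G :=
  smallest (fun A : set G => forall x y, A x -> A y -> A (x * y)) X.

Definition congruence (T : semigroupType) (r : set (T * T)) : Prop :=
  [/\ forall x, r (x, x),
      forall x y, r (x, y) -> r (y, x),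
      forall x y z, r (x, y) -> r (y, z) -> r (x, z) &
      forall x y x' y', r (x, y) -> r (x', y') -> r (x * x', y * y')].

Definition congr_gen (T : semigroupType) (r : set (T * T)) : set (T * T) :=
  smallest (@congruence T) r.

Section Quotient.
Variables (T : semigroupType) (r : set (T * T)).

Fact congr_gen_congruence : congruence (congr_gen r).
Proof.
split=> [x|x y h|x y z hx hy|x y x' y' h h'] A [] /[dup] cA [A1 A2 A3 A4] rA.
- exact: A1.
- by apply: A2; apply: h.
- by apply: (A3 x y z); [apply: hx|apply: hy].
- by apply: A4; [apply: h|apply: h'].
Qed.

Definition congr_genb : rel T := fun x y => `[< congr_gen r (x, y) >].

Fact congr_genb_refl : reflexive congr_genb.
Proof. by move=> x; apply/asboolP; case: congr_gen_congruence => h _ _ _. Qed.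

Fact congr_genb_sym : symmetric congr_genb.
Proof.
have [_ h _ _] := congr_gen_congruence.
by move=> x y; apply/asboolP/asboolP; exact: h.
Qed.

Fact congr_genb_trans : transitive congr_genb.
Proof.
have [_ _ h _] := congr_gen_congruence.
by move=> y x z /asboolP hx /asboolP hy; apply/asboolP; apply: (h _ y).
Qed.

Canonical congr_genb_equiv_rel :=
  EquivRel congr_genb congr_genb_refl congr_genb_sym congr_genb_trans.

(* T / r^#, the quotient of T by the congruence generated by r. *)
Definition quot : Type := {eq_quot congr_genb}%qT.
HB.instance Definition _ := Choice.copy quot {eq_quot congr_genb}%qT.

Definition quot_class (x : T) : quot := (\pi_({eq_quot congr_genb}) x)%qT.

Let quot_repr (a : quot) : T := repr (a : {eq_quot congr_genb}%qT).

Let quot_mul (a b : quot) : quot := quot_class (quot_repr a * quot_repr b).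

Fact quot_classP x y : quot_class x = quot_class y <-> congr_gen r (x, y).
Proof.
rewrite /quot_class; split=> [/eqquotP/asboolP//|h].
by apply/eqquotP/asboolP.
Qed.

Let quot_reprK a : quot_class (quot_repr a) = a.
Proof. exact: reprK. Qed.

Let quot_classM x y :
  quot_mul (quot_class x) (quot_class y) = quot_class (x * y).
Proof.
have [_ _ _ h] := congr_gen_congruence.
by apply/quot_classP; apply: h; apply/quot_classP; exact: quot_reprK.
Qed.

Fact quot_mulA : associative quot_mul.
Proof.
move=> a b c; rewrite -(quot_reprK a) -(quot_reprK b) -(quot_reprK c).
by rewrite !quot_classM mulgA.
Qed.

HB.instance Definition _ := isSemigroup.Build quot quot_mulA.

Fact quot_class_morph : {morph quot_class : x y / x * y}.
Proof. by move=> x y; rewrite -quot_classM. Qed.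

HB.instance Definition _ :=
  isMultiplicative.Build T quot quot_class quot_class_morph.
End Quotient.

Section ActionPair.
Variables (M : monoidType) (U S : mulgClosed M).
Variable act : sgaction (sub S) (sub (adjoin1 U)).

(* (A1) and (A2); the products of [val]s are taken in M *)
Definition action_pair : Prop :=
  (forall s u, val s * val u = val (act s u) * val s) /\
  (forall u v s t, val u * val s = val v * val t ->
     u * act s 1 = v * act t 1).

Definition splus (s : sub S) : sub (adjoin1 U) := act s 1.

(* <S^+>, the P of kappa *)
Definition Pplus : set (sub (adjoin1 U)) := generated (range splus).

Definition kappa : set (sub S * sub S) :=
  [set st | exists p q, [/\ Pplus p, Pplus q &
     val p * val st.1 = val q * val st.2]].

Definition sigma : set (sub S * sub S) := congr_gen kappa.

Definition proper_pair : Prop :=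
  action_pair /\
  forall u v s t, val u * val s = val v * val t <->
    u * splus s = v * splus t /\ sigma (s, t).

End ActionPair.

Definition proper_monoid (M : monoidType) (U S : umagmaClosed M)
    (act : sgaction (sub S) (sub (adjoin1 U))) : Prop :=
  proper_pair act /\
  forall m : M, exists (u : sub U) (s : sub S), m = val u * val s.

(* S/sigma; [sigma act] is [congr_gen (kappa act)], see [quot_classP] *)
Definition Ssigma (M : monoidType) (U S : mulgClosed M)
  (act : sgaction (sub S) (sub (adjoin1 U))) : semigroupType :=
  quot (kappa act).

Definition shat (M : monoidType) (U S : mulgClosed M)
  (act : sgaction (sub S) (sub (adjoin1 U))) (s : sub S) : Ssigma act :=
  quot_class (kappa act) s.

(* Main.v *)
Require Import Defs.
From HB Require Import structures.
From mathcomp Require Import all_boot.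
From mathcomp Require Import boolp classical_sets functions.

Set Implicit Arguments.
Unset Strict Implicit.
Unset Printing Implicit Defensive.

Local Open Scope group_scope.
Local Open Scope classical_set_scope.

(** Write [T] for [S/sigma] and [s^+] for [splus s].  By properness an element
    [u s] of [M] is determined by the pair [(u s^+, shat s)], so one looks for
    an embedding [u s |-> (f (u s^+), shat s)] with [f : U -> UC] an injective
    morphism.  This is multiplicative as soon as
      [f (s^+) * (shat s . f x) = f (act s x)].
    The difficulty is that [S], but not [T], acts on [U]: the elements of one
    [sigma]-class may act differently.

    The maps [act s] with [shat s = r] are however compatible, in the way of
    local sections to be glued: commutativity, properness and the axiom
    [us = vt => us^+ = vt^+] give [t^+ * act s x = s^+ * act t x] whenever
    [shat s = shat t] ([act_compatible]).  Up to multiplication by idempotents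
    they thus agree, and they can be collected in one set,
      [translate r x = {e * act s x | e idempotent, shat s = r}],
    which depends on [r] only.  Such sets live in the monoid [saturated U] of
    subsets of [U] closed under multiplication by central idempotents, with
    the pointwise product.  Compatibility makes [translate r] multiplicative
    ([translateM]) and yields
      [translate r (s^+) * translate (r * shat s) x = translate r (act s x)]
    ([translate_act]).  At [r = shat 1] one gets the set of the [e * x] with [e]
    idempotent, which determines [x], since [x = e y] and [y = e' x] force
    [x = y].

    It remains to let [UC] be the monoid of all functions [T -> saturated U]
    with the action [(t . g) r = g (r t)] and [f x = (r |-> translate r x)];
    the identity of [translate_act] is the one required of [f].  Saturation is
    what makes the construction preserve semilattices: in that case the product
    of two saturated sets is their intersection. *)

(** * Saturated subsets of a monoid *)

Definition central_idem (W : monoidType) (e : W) : Prop :=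
  e * e = e /\ forall x : W, e * x = x * e.

Record saturated (W : monoidType) : Type := Saturated {
  carrier : set W;
  saturatedP : forall e x, central_idem e -> carrier x -> carrier (e * x)
}.

HB.instance Definition _ (W : monoidType) := gen_eqMixin (saturated W).
HB.instance Definition _ (W : monoidType) := gen_choiceMixin (saturated W).

Lemma saturated_eq (W : monoidType) (X Y : saturated W) :
  (forall x : W, carrier X x <-> carrier Y x) -> X = Y.
Proof.
case: X Y => [X hX] [Y hY] /= eXY.
have {eXY} E : X = Y by apply/seteqP; split=> x /eXY.
by subst Y; rewrite (Prop_irrelevance hX hY).
Qed.

Lemma central_idem1 (W : monoidType) : central_idem (1 : W).
Proof. by split=> [|x]; rewrite ?mulg1 ?mul1g. Qed.

Lemma central_idemM (W : monoidType) (e f : W) :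
  central_idem e -> central_idem f -> central_idem (e * f).
Proof.
move=> [ee ce] [ff cf]; split=> [|x].
  by rewrite mulgA -(mulgA e f e) -ce mulgA ee -mulgA ff.
by rewrite -mulgA (cf x) mulgA (ce x) -mulgA.
Qed.

Section SaturatedMonoid.
Variable W : monoidType.
Implicit Types X Y Z : saturated W.

Fact sat_one_closed (e x : W) :
  central_idem e -> central_idem x -> central_idem (e * x).
Proof. exact: central_idemM. Qed.

(** The unit is the set of central idempotents, rather than [{1}]: it is the
    saturation of [{1}]. *)
Definition sat_one : saturated W := Saturated sat_one_closed.

Definition setmul (A B : set W) : set W := [set x * y | x in A & y in B].

Fact sat_mul_closed X Y (e x : W) : central_idem e ->
  setmul (carrier X) (carrier Y) x -> setmul (carrier X) (carrier Y) (e * x).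
Proof.
move=> he [a Xa [b Yb <-]]; exists (e * a); first exact: saturatedP.
by exists b => //; rewrite mulgA.
Qed.

Definition sat_mul X Y : saturated W := Saturated (sat_mul_closed (X := X) (Y := Y)).

Fact sat_mulA : associative sat_mul.
Proof.
move=> X Y Z; apply: saturated_eq => x; split.
- move=> [a Xa [_ [b Yb [c Zc <-]] <-]]; exists (a * b).
    by exists a => //; exists b.
  by exists c => //; rewrite mulgA.
- move=> [_ [a Xa [b Yb <-]] [c Zc <-]]; exists a => //; exists (b * c).
    by exists b => //; exists c.
  by rewrite mulgA.
Qed.

Fact sat_mul1 : left_id sat_one sat_mul.
Proof.
move=> X; apply: saturated_eq => x; split.
  by move=> [e he [y Xy <-]]; exact: saturatedP.
by move=> Xx; exists 1; [exact: central_idem1 | exists x; rewrite ?mul1g].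
Qed.

Fact sat_mulr1 : right_id sat_one sat_mul.
Proof.
move=> X; apply: saturated_eq => x; split.
  by move=> [y Xy [e he <-]]; rewrite -he.2; exact: saturatedP.
by move=> Xx; exists x => //; exists 1; [exact: central_idem1 | rewrite mulg1].
Qed.

HB.instance Definition _ :=
  isMonoid.Build (saturated W) sat_mulA sat_mul1 sat_mulr1.

Lemma saturated_comm :
  commutative_semigroup W -> commutative_semigroup (saturated W).
Proof.
move=> cW X Y; apply: saturated_eq => x.
split=> -[a Xa [b Yb <-]]; exists b => //; exists a => //; exact: cW.
Qed.

(** In a semilattice every element is a central idempotent, so that a product
    [x * y] of two elements of a saturated set [X] stays in [X]. *)
Lemma saturated_semilattice : semilattice W -> semilattice (saturated W).
Proof.
move=> [cW iW]; split=> [|X]; first exact: saturated_comm.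
apply: saturated_eq => x; split.
  by move=> [a Xa [b Xb <-]]; exact: saturatedP.
by move=> Xx; exists x => //; exists x => //; exact: iW.
Qed.
End SaturatedMonoid.

(** * Powers of a monoid *)

(** The functions from [T] to [A], under a name of their own so that the
    pointwise product does not compete with other structures on arrows. *)
Definition power (T : Type) (A : monoidType) : Type := T -> A.

HB.instance Definition _ (T : Type) (A : monoidType) := gen_eqMixin (power T A).
HB.instance Definition _ (T : Type) (A : monoidType) :=
  gen_choiceMixin (power T A).

Section Power.
Variables (T : Type) (A : monoidType).
Implicit Types f g h : power T A.

Definition power_mul f g : power T A := fun r => f r * g r.
Definition power_one : power T A := fun=> 1.

Fact power_mulA : associative power_mul.
Proof. by move=> f g h; apply: funext => r; rewrite /power_mul mulgA. Qed.

Fact power_mul1 : left_id power_one power_mul.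
Proof. by move=> f; apply: funext => r; rewrite /power_mul mul1g. Qed.

Fact power_mulr1 : right_id power_one power_mul.
Proof. by move=> f; apply: funext => r; rewrite /power_mul mulg1. Qed.

HB.instance Definition _ :=
  isMonoid.Build (power T A) power_mulA power_mul1 power_mulr1.

Lemma power_comm : commutative_semigroup A -> commutative_semigroup (power T A).
Proof. by move=> cA f g; apply: funext => r; exact: cA. Qed.

Lemma power_semilattice : semilattice A -> semilattice (power T A).
Proof.
move=> [cA iA]; split=> [|f]; first exact: power_comm.
by apply: funext => r; exact: iA.
Qed.
End Power.

Section ShiftAction.
Variables (T : semigroupType) (A : monoidType).

Definition shift (t : T) (g : power T A) : power T A := fun r => g (r * t).

Fact shiftM s t g : shift s (shift t g) = shift (s * t) g.
Proof. by apply: funext => r; rewrite /shift mulgA. Qed.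

Fact shift_morph s : {morph shift s : f g / f * g}.
Proof. by []. Qed.

Definition shift_act : sgaction T (power T A) :=
  SgAction shiftM shift_morph.
End ShiftAction.

(** * Proper monoids with commutative left factor *)

Section ProperMonoid.
Variables (M : monoidType) (U S : umagmaClosed M).
Variable act : sgaction (sub S) (sub (adjoin1 U)).
Hypothesis properM : proper_monoid act.
Hypothesis commU : commutative_semigroup (sub U).

Local Notation W := (sub (adjoin1 U)).
Local Notation T := (Ssigma act).
Local Notation hat := (shat act).
Local Notation plus := (splus act).

Lemma adjoin1_submonoid (x : M) : (x \in adjoin1 U) = (x \in U).
Proof. by rewrite !inE; case: eqP => // ->; rewrite gpred1. Qed.

(** As [U] already contains the identity, [U^1] is [U] up to this bijection. *)
Definition to_adjoin1 (u : sub U) : W :=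
  Sub (val u) (etrans (adjoin1_submonoid (val u)) (valP u)).

Definition of_adjoin1 (w : W) : sub U :=
  Sub (val w) (etrans (esym (adjoin1_submonoid (val w))) (valP w)).

Lemma to_adjoin1M : {morph to_adjoin1 : u v / u * v}.
Proof. by move=> u v; apply: val_inj. Qed.

Lemma to_adjoin1K : cancel to_adjoin1 of_adjoin1.
Proof. by move=> u; apply: val_inj. Qed.

Lemma of_adjoin1K : cancel of_adjoin1 to_adjoin1.
Proof. by move=> u; apply: val_inj. Qed.

Lemma commW : commutative (@mul W).
Proof.
by move=> u v; rewrite -(of_adjoin1K u) -(of_adjoin1K v) -!to_adjoin1M commU.
Qed.

Lemma mulW_AC (u v w : W) : u * (v * w) = v * (u * w).
Proof. by rewrite mulgA (commW u) -mulgA. Qed.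

Lemma actA1 s u : val s * val u = val (act s u) * val s.
Proof. by case: properM => -[[h _] _] _. Qed.

Lemma actA2 u v s t : val u * val s = val v * val t -> u * plus s = v * plus t.
Proof. by case: properM => -[[_ h] _] _; exact: h. Qed.

Lemma properP u v s t :
  val u * val s = val v * val t <-> u * plus s = v * plus t /\ hat s = hat t.
Proof.
case: properM => -[_ h] _; split=> [/h[? ?]|[? ?]].
  by split=> //; apply/quot_classP.
by apply/h; split=> //; apply/quot_classP.
Qed.

Lemma hatM s t : hat (s * t) = hat s * hat t.
Proof. exact: quot_class_morph. Qed.

Lemma hat_surj (r : T) : exists s, hat s = r.
Proof.
exists (repr (r : {eq_quot congr_genb (kappa act)}%qT)).
exact: (@reprK _ {eq_quot congr_genb (kappa act)}%qT r).
Qed.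

Lemma hat1r (r : T) : r * hat 1 = r.
Proof. by have [s <-] := hat_surj r; rewrite -hatM mulg1. Qed.

Lemma act1 u : act 1 u = u.
Proof. by apply: val_inj; have := actA1 1 u; rewrite mul1g mulg1. Qed.

Lemma splus1 : plus 1 = 1.
Proof. exact: act1. Qed.

Lemma splusM s t : plus (s * t) = act s (plus t).
Proof. by rewrite /splus sgactM. Qed.

Lemma splus_act s x : plus s * act s x = act s x.
Proof. by rewrite /splus -sgact_morph mul1g. Qed.

Lemma splus_idem s : plus s * plus s = plus s.
Proof. exact: splus_act. Qed.

(** By properness [plus t * s = plus s * t] in [M], since
    [plus t * plus s = plus s * plus t].  Multiply by [x] on the right and move
    it to the left of [s] and [t]: the resulting [U] parts are the two sides of
    the claim, up to the factors [plus s] and [plus t], which they absorb. *)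
Lemma act_compatible s t x :
  hat s = hat t -> plus t * act s x = plus s * act t x.
Proof.
move=> hst.
have eM : val (plus t) * val s = val (plus s) * val t.
  by apply/properP; split; first exact: commW.
have : val (plus t * act s x) * val s = val (plus s * act t x) * val t.
  by rewrite !valM -!mulgA -!actA1 !mulgA eM.
by move/actA2; rewrite -!mulgA !(commW (act _ _) (plus _)) !splus_act.
Qed.

Definition translate_set (r : T) (x : W) : set W :=
  [set y | exists e s, [/\ central_idem e, hat s = r & y = e * act s x]].

Fact translate_closed r x (e y : W) :
  central_idem e -> translate_set r x y -> translate_set r x (e * y).
Proof.
move=> he [f [s [hf hs ->]]]; exists (e * f), s; split=> //.
- exact: central_idemM.
- by rewrite mulgA.
Qed.

Definition translate (r : T) (x : W) : saturated W :=
  Saturated (translate_closed (r := r) (x := x)).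

Lemma splus_central s : central_idem (plus s).
Proof. by split; [exact: splus_idem | exact: commW]. Qed.

(** Compatibility turns [act s x * act t y] into
    [plus t * act s (x * y)], for [s] and [t] in the same class. *)
Lemma translateM r : {morph translate r : x y / x * y}.
Proof.
move=> x y; apply: saturated_eq => z; split.
  move=> [e [s [he hs ->]]]; exists (e * act s x); first by exists e, s.
  exists (e * act s y); first by exists e, s.
  by rewrite sgact_morph -mulgA (mulW_AC (act s x)) !mulgA he.1.
move=> [_ [e [s [he hs ->]]] [_ [f [t [hf ht ->]]] <-]].
exists (e * f * plus t), s; split=> //.
  by apply: central_idemM; [exact: central_idemM | exact: splus_central].
have E : act s x * act t y = plus t * act s (x * y).
  rewrite -(splus_act s x) (commW (plus s)) -mulgA.
  rewrite -(act_compatible (s := s) (t := t) y) ?hs ?ht //.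
  by rewrite mulW_AC sgact_morph.
by rewrite -!mulgA -E (mulW_AC (act s x)).
Qed.

(** The product of [act t (plus s) = plus (t * s)] and [act w x], for [w] in the
    class of [t * s], is [plus w * act (t * s) x] by compatibility. *)
Lemma translate_act r s x :
  translate r (plus s) * translate (r * hat s) x = translate r (act s x).
Proof.
apply: saturated_eq => z; split.
  move=> [_ [e [t [he ht ->]]] [_ [f [w [hf hw ->]]] <-]].
  exists (e * f * plus w), t; split=> //.
    by apply: central_idemM; [exact: central_idemM | exact: splus_central].
  rewrite -splusM sgactM -!mulgA (mulW_AC _ f).
  rewrite (act_compatible (s := t * s) (t := w)) //.
  by rewrite hatM ht hw.
move=> [e [t [he ht ->]]].
exists (e * act t (plus s)); first by exists e, t.
exists (e * act (t * s) x); first by exists e, (t * s); rewrite hatM ht.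
by rewrite -splusM -mulgA (mulW_AC _ e) splus_act mulgA he.1 sgactM.
Qed.

(** [x] belongs to [translate (hat 1) x], all of whose elements are multiples
    of [x] by an idempotent.  Being such a multiple of each other is an
    antisymmetric relation in a commutative monoid. *)
Lemma translate1_inj : injective (translate (hat 1)).
Proof.
have le x y : translate (hat 1) x = translate (hat 1) y ->
    exists2 e : W, central_idem e & x = e * y.
  move=> E; have : carrier (translate (hat 1) y) x.
    rewrite -E; exists 1, 1.
    by split=> //; [exact: central_idem1 | rewrite mul1g act1].
  move=> [e [s [he hs ->]]]; exists (e * plus s).
    by apply: central_idemM => //; exact: splus_central.
  have := act_compatible (s := s) (t := 1) y hs.
  by rewrite splus1 mul1g act1 -mulgA => ->.
move=> x y E; have [e [ee _] xE] := le _ _ E.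
have [f _ yE] := le _ _ (esym E).
have ex : e * x = x by rewrite xE mulgA ee.
by rewrite xE yE (mulW_AC e) ex.
Qed.

(** * The embedding *)

Definition embU (x : W) : power T (saturated W) := fun r => translate r x.

Lemma embUM : {morph embU : x y / x * y}.
Proof. by move=> x y; apply: funext => r; exact: translateM. Qed.

Lemma embU_act s x :
  embU (plus s) * shift_act T (saturated W) (hat s) (embU x) = embU (act s x).
Proof. by apply: funext => r; exact: translate_act. Qed.

Lemma embU_inj : injective embU.
Proof. by move=> x y /(congr1 (@^~ (hat 1))) /translate1_inj. Qed.

Lemma shift_hat1 (g : power T (saturated W)) :
  shift_act T (saturated W) (hat 1) g = g.
Proof. by apply: funext => r; rewrite /= /shift hat1r. Qed.

Lemma factorization (m : M) :
  exists us : W * sub S, m = val us.1 * val us.2.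
Proof.
case: properM => _ /(_ m)[u [s ->]].
by exists (to_adjoin1 u, s).
Qed.

Local Notation SD := (semidirect (shift_act T (saturated W))).

Definition embM (m : M) : SD :=
  let us := projT1 (cid (factorization m)) in
  (embU (us.1 * plus us.2), hat us.2).

(** Properness makes the choice of a factorization in [embM] immaterial. *)
Lemma embME u s : embM (val u * val s) = (embU (u * plus s), hat s).
Proof.
rewrite /embM; case: cid => -[v t] /= /properP[uv st].
by rewrite uv st.
Qed.

Fact embM_morph : {morph embM : m n / m * n}.
Proof.
move=> m n.
have [[u s] /= ->] := factorization m; have [[v t] /= ->] := factorization n.
have -> : val u * val s * (val v * val t) =
          val (u * act s v) * val (s * t).
  by rewrite !valM -!mulgA (mulgA (val (act s v))) -actA1 !mulgA.
rewrite !embME splusM -mulgA -sgact_morph embUM -embU_act hatM.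
by rewrite mulgA -embUM.
Qed.

HB.instance Definition _ := isMultiplicative.Build M SD embM embM_morph.

Definition embM_hom : {multiplicative M -> SD} := embM.

Lemma embM_inj : injective embM.
Proof.
move=> m n.
have [[u s] /= ->] := factorization m; have [[v t] /= ->] := factorization n.
by rewrite !embME => -[/embU_inj uv st]; apply/properP.
Qed.

Lemma embM_on_U u : embM (val u) = (embU (to_adjoin1 u), hat 1).
Proof. by have := embME (to_adjoin1 u) 1; rewrite splus1 !mulg1. Qed.

Definition imgU : {pred power T (saturated W)} :=
  fun g => `[< exists x, g = embU x >].

Fact imgU_closed : mulg_closed imgU.
Proof.
move=> _ _ /asboolP[x ->] /asboolP[y ->]; apply/asboolP.
by exists (x * y); rewrite embUM.
Qed.

HB.instance Definition _ := isMulClosed.Build _ imgU imgU_closed.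

Definition imgU_subsemigroup : mulgClosed (power T (saturated W)) := imgU.

Lemma imgU_mem x : embU x \in imgU.
Proof. by apply/asboolP; exists x. Qed.

Definition iso_imgU (u : sub U) : sub imgU :=
  Sub (embU (to_adjoin1 u)) (imgU_mem _).

Fact iso_imgUM : {morph iso_imgU : u v / u * v}.
Proof. by move=> u v; apply: val_inj; rewrite /= to_adjoin1M embUM. Qed.

HB.instance Definition _ :=
  isMultiplicative.Build (sub U) (sub imgU) iso_imgU iso_imgUM.

Lemma isomorphic_imgU : isomorphic (sub U) (sub imgU).
Proof.
exists iso_imgU.
have surj (g : sub imgU) : exists u, iso_imgU u = g.
  have /asboolP[x gx] := valP g; exists (of_adjoin1 x).
  by apply: val_inj; rewrite /= of_adjoin1K gx.
have [g gK] := choice surj; exists g => // u.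
apply: (can_inj to_adjoin1K); apply: embU_inj.
exact: (congr1 val (gK (iso_imgU u))).
Qed.

Lemma slice_imgU_closed :
  mulg_closed (slice (shift_act T (saturated W)) imgU (hat 1)).
Proof.
move=> [g r] [h t] /andP[/= gU /eqP->] /andP[/= hU /eqP->].
apply/andP; split; last by apply/eqP; exact: hat1r.
change (g * shift_act T (saturated W) (hat 1) h \in imgU).
by rewrite shift_hat1; exact: imgU_closed.
Qed.

Lemma embM_bij :
  set_bij [set u | u \in U]
    [set x | x \in slice (shift_act T (saturated W)) imgU (hat 1)] embM.
Proof.
split.
- move=> u uU; rewrite /= (embM_on_U (Sub u uU)).
  by apply/andP; rewrite /= imgU_mem.
- by move=> u v _ _; exact: embM_inj.
- move=> [g r] /andP[/= /asboolP[x ->] /eqP->].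
  exists (val (of_adjoin1 x)); first exact: valP.
  by rewrite embM_on_U of_adjoin1K.
Qed.

Lemma semilattice_adjoin1 : idempotent_op (@mul (sub U)) -> semilattice W.
Proof.
move=> iU; split=> [|w]; first exact: commW.
by rewrite -(of_adjoin1K w) -to_adjoin1M iU.
Qed.
End ProperMonoid.

Theorem theorem5p82 (M : monoidType) (U S : umagmaClosed M)
    (act : sgaction (sub S) (sub (adjoin1 U)))
    (C : semigroupType -> Prop) :
  proper_monoid act ->
  C = commutative_semigroup \/ C = semilattice ->
  C (sub U) ->
  exists (UC : monoidType) (actC : sgaction (Ssigma act) UC)
         (psi : {multiplicative M -> semidirect actC}),
    [/\ injective psi,
        C UC &
        exists U' : mulgClosed UC,
        [/\ isomorphic (sub U) (sub U'),
            mulg_closed (slice actC U' (shat act 1)) &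
            set_bij [set u | u \in U]
                    [set x | x \in slice actC U' (shat act 1)] psi]].
Proof.
move=> properM CE CU.
have commU : commutative_semigroup (sub U) by case: CE CU => -> // -[].
exists (power (Ssigma act) (saturated (sub (adjoin1 U)))).
exists (shift_act (Ssigma act) (saturated (sub (adjoin1 U)))).
exists (embM_hom properM commU); split.
- exact: embM_inj.
- case: CE CU => -> CU.
    exact (power_comm (saturated_comm (commW commU))).
  have semW := semilattice_adjoin1 CU.1 CU.2.
  exact (power_semilattice _ (saturated_semilattice semW)).
- exists (imgU_subsemigroup properM commU); split.
  + exact: isomorphic_imgU.
  + exact: slice_imgU_closed.
  + exact: embM_bij.
Qed.
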